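(* Let $(V, *, \{C_n\}_{n\ge 1}, e)$ be an abstract real operator system. Then there exist a real Hilbert space $H$ and a unital (selfadjoint) complete order embedding $\pi : V \to B(H)$.
   Context: An involution on a real vector space $V$ is a real linear map $x \mapsto x^*$ with $(x^* )^* = x$; it extends to $M_n(V)$ by letting the $(i,j)$ entry of $x^*$ be $x_{ji}^*$. Write $M_n(V)_{\rm sa}=\{x\in M_n(V): x=x^*\}$. A real matrix ordering is a sequence of subsets $C_n \subseteq M_n(V)_{\rm sa}$ ($n\in\mathbb{N}$) such that $C_n \oplus C_m \subseteq C_{n+m}$ and $\alpha^T C_n \alpha \subseteq C_m$ for all $n,m$ and all $\alpha \in M_{n,m}(\mathbb{R})$; it is proper if $C_n\cap -C_n=\{0\}$ for all $n$. For $e\in V_{\rm sa}$ let $e_n = {\rm diag}(e,\dots,e)\in M_n(V)$. The element $e$ is a matrix order unit if for every $n$ and $x\in M_n(V)_{\rm sa}$ there is $t>0$ with $te_n+x\in C_n$; it is archimedean if whenever $x\in M_n(V)_{\rm sa}$ and $te_n+x\in C_n$ for all $t>0$, then $x\in C_n$. An abstract real operator system is a tuple $(V,*,\{C_n\},e)$ where $V$ is a real vector space, $*$ an involution, $\{C_n\}$ a proper real matrix ordering and $e\in V_{\rm sa}$ an archimedean matrix order unit. For a real Hilbert space $H$, $M_n(B(H))\cong B(H^n)$, and its positive elements are the selfadjoint operators $x$ with $\langle xh,h\rangle\ge 0$ for all $h\in H^n$. A unital selfadjoint complete order embedding $\pi:V\to B(H)$ is an injective real linear map with $\pi(e)=I$,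 $\pi(x^* )=\pi(x)^*$, and such that for all $n$ and $x\in M_n(V)$: $x\in C_n$ if and only if $\pi^{(n)}(x)=[\pi(x_{ij})]\ge 0$. *)

(* Defs.v *)
From HB Require Import structures.
From mathcomp Require Import all_boot all_order all_algebra.
From mathcomp Require Import sesquilinear.
From mathcomp Require Import all_classical all_reals all_analysis.

Set Implicit Arguments.
Unset Strict Implicit.
Unset Printing Implicit Defensive.

Import Order.TTheory GRing.Theory Num.Theory.
Import numFieldNormedType.Exports.

Local Open Scope classical_set_scope.
Local Open Scope ring_scope.

(* Matrices over a real vector space V. Indices n range over the positive
   integers, so every axiom carries the guard (0 < n)%N; the component C 0 of
   a family C is irrelevant throughout. *)

Section MatrixOrdering.
Variables (R : realType) (V : lmodType R).

Definition mxstar (star : V -> V) n (x : 'M[V]_n) : 'M[V]_n :=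
  map_mx star x^T.

Definition mxsa (star : V -> V) n : set 'M[V]_n := [set x | mxstar star x = x].

(* alpha^T x alpha; not [*m], because x has entries in a module over R *)
Definition mxcompress n m (alpha : 'M[R]_(n, m)) (x : 'M[V]_n) : 'M[V]_m :=
  \matrix_(i, j) \sum_(k < n) \sum_(l < n) (alpha k i * alpha l j) *: x k l.

Definition mxdiag_of (v : V) n : 'M[V]_n := \matrix_(i, j) (v *+ (i == j)).

Definition involution (star : {linear V -> V}) : Prop := involutive star.

Record real_matrix_ordering (star : {linear V -> V})
    (C : forall n, set 'M[V]_n) : Prop := RealMatrixOrdering {
  rmo_sa : forall n, (0 < n)%N -> C n `<=` mxsa star (n := n);
  rmo_oplus : forall n m, (0 < n)%N -> (0 < m)%N ->
    forall (x : 'M[V]_n) (y : 'M[V]_m), C n x -> C m y ->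
    C (n + m)%N (block_mx x 0 0 y);
  rmo_compress : forall n m, (0 < n)%N -> (0 < m)%N ->
    forall alpha : 'M[R]_(n, m), mxcompress alpha @` C n `<=` C m }.

Definition proper_ordering (C : forall n, set 'M[V]_n) : Prop :=
  forall n, (0 < n)%N -> C n `&` (-%R @` C n) = [set 0].

Definition matrix_order_unit (star : {linear V -> V})
    (C : forall n, set 'M[V]_n) (e : V) : Prop :=
  forall n, (0 < n)%N -> forall x : 'M[V]_n, mxsa star x ->
  exists2 t : R, 0 < t & C n (map_mx ( *:%R t) (mxdiag_of e n) + x).

Definition archimedean_unit (star : {linear V -> V})
    (C : forall n, set 'M[V]_n) (e : V) : Prop :=
  forall n, (0 < n)%N -> forall x : 'M[V]_n, mxsa star x ->
  (forall t : R, 0 < t -> C n (map_mx ( *:%R t) (mxdiag_of e n) + x)) ->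
  C n x.

Record real_operator_system (star : {linear V -> V})
    (C : forall n, set 'M[V]_n) (e : V) : Prop := RealOperatorSystem {
  ros_involution : involution star;
  ros_ordering : real_matrix_ordering star C;
  ros_proper : proper_ordering C;
  ros_unit_sa : star e = e;
  ros_order_unit : matrix_order_unit star C e;
  ros_archimedean : archimedean_unit star C e }.

End MatrixOrdering.

(* A complete normed space whose norm comes from a (positive definite,
   symmetric, bilinear) inner product. *)
Record hilbertType (R : realType) := HilbertType {
  hilbert_sort :> completeNormedModType R;
  hdot : {dot hilbert_sort for idfun};
  hdot_norm : forall h : hilbert_sort, hdot h h = `|h| ^+ 2 }.

Arguments hdot {R H} : rename.

Section BoundedOperators.
Variables (R : realType) (H : hilbertType R).

Definition is_bounded_operator : {pred H -> H} :=
  [pred f : H -> H | `[< linear f /\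
    exists M : R, forall h : H, `|f h| <= M * `|h| >]].

Lemma is_bounded_operator_submod : submod_closed is_bounded_operator.
Proof.
split.
  apply/asboolP; split=> [a h k|]; first by rewrite /= scaler0 addr0.
  by exists 0 => h; rewrite normr0 mul0r.
move=> a f g /asboolP[lf [M fM]] /asboolP[lg [N gN]]; apply/asboolP; split.
  move=> b h k; rewrite /= !fctE lf lg !scalerDr !scalerA.
  by rewrite (mulrC a b) addrACA.
exists (`|a| * M + N) => h; rewrite mulrDl; apply: le_trans (ler_normD _ _) _.
by rewrite lerD// -mulrA normrZ ler_wpM2l.
Qed.

HB.instance Definition _ :=
  GRing.isSubmodClosed.Build R (H -> H) is_bounded_operator
    is_bounded_operator_submod.

Record bounded_operator := BoundedOperator {
  bounded_fun :> H -> H;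
  bounded_funP : bounded_fun \in is_bounded_operator }.

HB.instance Definition _ := [isSub for bounded_fun].
HB.instance Definition _ := gen_eqMixin bounded_operator.
HB.instance Definition _ := gen_choiceMixin bounded_operator.
HB.instance Definition _ := [SubChoice_isSubLmodule of bounded_operator by <:].

Lemma id_is_bounded_operator : (idfun : H -> H) \in is_bounded_operator.
Proof. by apply/asboolP; split=> //; exists 1 => h; rewrite mul1r. Qed.

Definition id_operator : bounded_operator :=
  BoundedOperator id_is_bounded_operator.

(* S is the adjoint T^* of T; it is unique, the inner product being definite *)
Definition is_adjoint (T S : bounded_operator) : Prop :=
  forall h k : H, hdot (T h) k = hdot h (S k).

(* H^n is ['I_n -> H], with the inner product [hdotn]; a matrix over B(H) acts
   on it by [opmx_app], which is the identification of M_n(B(H)) with B(H^n). *)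
Definition hdotn n (h k : 'I_n -> H) : R := \sum_(i < n) hdot (h i) (k i).

Definition opmx_app n (x : 'M[bounded_operator]_n) (h : 'I_n -> H) : 'I_n -> H :=
  fun i => \sum_(j < n) x i j (h j).

(* Over the reals, selfadjointness does not follow from the second clause. *)
Definition opmx_pos n (x : 'M[bounded_operator]_n) : Prop :=
  (forall h k : 'I_n -> H,
     hdotn (opmx_app x h) k = hdotn h (opmx_app x k)) /\
  (forall h : 'I_n -> H, 0 <= hdotn (opmx_app x h) h).

End BoundedOperators.

Record unital_complete_order_embedding (R : realType) (V : lmodType R)
    (star : {linear V -> V}) (C : forall n, set 'M[V]_n) (e : V)
    (H : hilbertType R) (pi : {linear V -> bounded_operator H}) : Prop :=
  UnitalCompleteOrderEmbedding {
  ucoe_inj : injective pi;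
  ucoe_unital : pi e = id_operator H;
  ucoe_star : forall x : V, is_adjoint (pi x) (pi (star x));
  ucoe_pos : forall n, (0 < n)%N -> forall x : 'M[V]_n,
    C n x <-> opmx_pos (map_mx pi x) }.

(* Main.v *)
(* A selfadjoint x in M_n(V) outside C_n is separated from C_n by a positive
   functional s on M_n(V) with s x < 0 (Hahn-Banach for the sublinear functional
   y |-> inf {t | t e_n - y - y^* in C_n}; the archimedean axiom makes the
   separation strict). Then v |-> [s (E_ij (x) v)]_ij is a completely positive
   map V -> M_n(R) that is negative on x. After a small perturbation of s its
   value at e is positive definite, so a congruence makes the map unital. The
   direct sum, over all unital completely positive maps f : V -> M_d(R), of the
   spaces R^d carries the required embedding. The bounds come from
   [[t e, v], [v^*, t e]] in C_2, and injectivity from [[0, v], [v^*, 0]],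
   which lies in C_2 and in -C_2 as soon as all f kill v. *)

From HB Require Import structures.
Require Import Defs.
From mathcomp Require Import all_boot all_order all_algebra.
From mathcomp Require Import sesquilinear finmap ring lra.
From mathcomp Require Import all_classical all_reals all_analysis.
From mathcomp Require summability.

Set Implicit Arguments.
Unset Strict Implicit.
Unset Printing Implicit Defensive.

Import Order.TTheory GRing.Theory Num.Theory.
Import numFieldNormedType.Exports.
Import summability.
Local Open Scope classical_set_scope.
Local Open Scope ring_scope.

#[local] Existing Instance totally_filter.

(** * The Hilbert space of square-summable families *)

Section FiniteSums.
Variables (R : realType) (J : choiceType).
Implicit Types (f g : J -> R) (A B : {fset J}).

Definition fsum f A : R := \sum_(j <- A) f j.

Lemma fsumD f g A : fsum (fun j => f j + g j) A = fsum f A + fsum g A.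
Proof. exact: big_split. Qed.

Lemma fsumZ (a : R) f A : fsum (fun j => a * f j) A = a * fsum f A.
Proof. by rewrite /fsum mulr_sumr. Qed.

Lemma le_fsum f A B : (forall j, 0 <= f j) -> (A `<=` B)%fset ->
  fsum f A <= fsum f B.
Proof.
move=> f0 AB; rewrite /fsum [leRHS](big_fsetID _ [in A]%fset) /=.
rewrite (_ : [fset x | x in B & x \in A]%fset = A) ?lerDl ?sumr_ge0//.
apply/fsetP => x; rewrite !inE /=.
by case: (boolP (x \in A)) => [/(fsubsetP AB) ->|]; rewrite ?andbF.
Qed.

Lemma near_totally A : \forall B \near totally, (A `<=` B)%fset.
Proof. by exists A. Qed.

(** The partial sums increase along inclusion of finite sets and are bounded, so they converge to
    their supremum. *)
Lemma is_cvg_fsum_ge0 f (M : R) : (forall j, 0 <= f j) ->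
  (forall A, fsum f A <= M) -> cvg (fsum f @ totally).
Proof.
move=> f0 fM; set S := range (fsum f).
have supS : has_sup S.
  by split; [exists (fsum f fset0); exists fset0|exists M => _ [A _ <-]].
apply/cvg_ex; exists (sup S); apply/cvgrPdist_le => eps eps0.
have [_ [A _ <-] hA] := sup_adherent eps0 supS.
near=> B.
have AB : (A `<=` B)%fset by near: B; exact: near_totally.
rewrite ger0_norm ?subr_ge0.
  by rewrite lerBlDl -lerBlDr (le_trans (ltW hA))// le_fsum.
by apply: sup_upper_bound => //; exists B.
Unshelve. all: by end_near. Qed.

End FiniteSums.

Section SquareSummable.
Variables (R : realType) (J : choiceType).

(** Stated through a uniform bound on finite partial sums, so that [J] may be uncountable; it will
    index the coordinates of all unital completely positive maps. *)
Definition square_summable : {pred J -> R} :=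
  [pred f : J -> R | `[< exists M : R,
     forall A : {fset J}, fsum (fun j => f j ^+ 2) A <= M >]].

Lemma square_summable_submod : submod_closed square_summable.
Proof.
split.
  by apply/asboolP; exists 0 => A; rewrite /fsum big1// => j _; rewrite expr0n.
move=> a f g /asboolP[M fM] /asboolP[N gN]; apply/asboolP.
(* From [(a f + g)^2 <= 2 a^2 f^2 + 2 g^2], which is [0 <= (a f - g)^2]. *)
exists (2 * a ^+ 2 * M + 2 * N) => A.
have /le_trans : fsum (fun j => (a * f j + g j) ^+ 2) A <=
    fsum (fun j => 2 * a ^+ 2 * f j ^+ 2 + 2 * g j ^+ 2) A.
  by apply: ler_sum => j _; have := sqr_ge0 (a * f j - g j); nra.
apply; rewrite fsumD !fsumZ; apply: lerD; apply: ler_wpM2l => //.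
by rewrite mulr_ge0// sqr_ge0.
Qed.

HB.instance Definition _ :=
  GRing.isSubmodClosed.Build R (J -> R) square_summable square_summable_submod.

Record l2 := L2 { l2_fun :> J -> R; l2_funP : l2_fun \in square_summable }.

HB.instance Definition _ := [isSub for l2_fun].
HB.instance Definition _ := gen_eqMixin l2.
HB.instance Definition _ := gen_choiceMixin l2.
HB.instance Definition _ := [SubChoice_isSubLmodule of l2 by <:].

Implicit Types f g h : l2.

Lemma l2_eqP f g : (forall j, f j = g j) -> f = g.
Proof. by move=> fg; apply/val_inj/funext. Qed.

Lemma l2D f g j : (f + g : l2) j = f j + g j. Proof. by []. Qed.

Lemma l2Z a f j : (a *: f : l2) j = a * f j. Proof. by []. Qed.

Lemma is_cvg_l2sq f : cvg (fsum (fun j => f j ^+ 2) @ totally).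
Proof.
have /asboolP[M fM] := l2_funP f.
by apply: is_cvg_fsum_ge0 fM => j; exact: sqr_ge0.
Qed.

(** Polarization writes the sum of products as a combination of three convergent sums of squares. *)
Lemma is_cvg_l2dot f g : cvg (fsum (fun j => f j * g j) @ totally).
Proof.
have -> : fsum (fun j => f j * g j) = fun A =>
    2^-1 * (fsum (fun j => (f + g : l2) j ^+ 2) A
            + -1 * fsum (fun j => f j ^+ 2) A + -1 * fsum (fun j => g j ^+ 2) A).
  apply/funext => A; rewrite -!fsumZ -!fsumD -fsumZ.
  apply: eq_bigr => j _.
  by rewrite l2D; field.
apply: is_cvgMr; apply: is_cvgD; [apply: is_cvgD|].
- exact: is_cvg_l2sq.
- by apply: is_cvgMr; exact: is_cvg_l2sq.
- by apply: is_cvgMr; exact: is_cvg_l2sq.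
Qed.

Definition l2dot f g : R := lim (fsum (fun j => f j * g j) @ totally).

Lemma cvg_l2dot f g : fsum (fun j => f j * g j) @ totally --> l2dot f g.
Proof. exact: is_cvg_l2dot. Qed.

Lemma l2dot_eq f g (l : R) :
  fsum (fun j => f j * g j) @ totally --> l -> l2dot f g = l.
Proof. by move=> /cvg_lim; apply. Qed.

Lemma l2dotC f g : l2dot f g = l2dot g f.
Proof.
rewrite /l2dot (_ : (fun j => f j * g j) = fun j => g j * f j)//.
by apply/funext => j; rewrite mulrC.
Qed.

Lemma l2dot_linear h a f g : l2dot h (a *: f + g) = a * l2dot h f + l2dot h g.
Proof.
apply: l2dot_eq.
rewrite (_ : fsum _ = fun A =>
    a * fsum (fun j => h j * f j) A + fsum (fun j => h j * g j) A).
  by apply: cvgD; [apply: cvgMr|]; exact: cvg_l2dot.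
apply/funext => A; rewrite -fsumZ -fsumD; apply: eq_bigr => j _.
by rewrite l2D l2Z; ring.
Qed.

Lemma fsum_le_l2dot f A : fsum (fun j => f j ^+ 2) A <= l2dot f f.
Proof.
apply: limr_ge; first exact: is_cvg_l2dot.
near=> B.
apply: (le_fsum (f := fun j => f j ^+ 2)) => [j|]; first exact: sqr_ge0.
by near: B; exact: near_totally.
Unshelve. all: by end_near. Qed.

Lemma l2dot_le f (M : R) :
  (forall A, fsum (fun j => f j ^+ 2) A <= M) -> l2dot f f <= M.
Proof.
move=> fM; apply: limr_le; first exact: is_cvg_l2dot.
by apply: nearW => A; exact: fM.
Qed.

Lemma sqr_le_l2dot f j : f j ^+ 2 <= l2dot f f.
Proof.
by have := fsum_le_l2dot f [fset j]%fset; rewrite /fsum big_seq_fset1.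
Qed.

Fact l2dot_bilinear : bilinear_for *%R (idfun \; *%R) l2dot.
Proof.
split=> [h|h] a f g /=; last exact: l2dot_linear.
by rewrite ![l2dot _ h]l2dotC l2dot_linear.
Qed.

HB.instance Definition _ :=
  bilinear_isBilinear.Build R l2 l2 R *%R (idfun \; *%R) l2dot l2dot_bilinear.

Fact l2dot_sym f g : l2dot f g = (-1) ^+ false * idfun (l2dot g f).
Proof. by rewrite mul1r l2dotC. Qed.

HB.instance Definition _ :=
  isHermitianSesquilinear.Build R l2 false idfun l2dot l2dot_sym.

(** Each squared coordinate is at most [l2dot f f], so a zero value kills every coordinate. *)
Fact l2dot_gt0 f : f != 0 -> 0 < l2dot f f.
Proof.
move=> f0; rewrite lt_neqAle (le_trans _ (fsum_le_l2dot f fset0)) ?andbT; last first.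
  by rewrite /fsum big_nil.
apply: contra f0 => /eqP f0; apply/eqP/l2_eqP => j; apply/eqP.
by rewrite -sqrf_eq0 eq_le sqr_ge0 andbT f0 sqr_le_l2dot.
Qed.

HB.instance Definition _ := isDotProduct.Build R l2 l2dot l2dot_gt0.

End SquareSummable.

(** * Norm and completeness of the space of square-summable families *)

Section L2Hilbert.
Variables (R : realType) (J : choiceType).
Implicit Types f g h : l2 R J.

Lemma l2dotDr f g h : l2dot f (g + h) = l2dot f g + l2dot f h.
Proof. by have := l2dot_linear f 1 g h; rewrite scale1r mul1r. Qed.

Lemma l2dotZr a f g : l2dot f (a *: g) = a * l2dot f g.
Proof.
have f0 : l2dot f 0 = 0.
  by have := l2dotDr f 0 0; rewrite addr0 => /eqP; rewrite -subr_eq subrr => /eqP.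
by have := l2dot_linear f a g 0; rewrite addr0 f0 addr0.
Qed.

Lemma l2dotDl f g h : l2dot (f + g) h = l2dot f h + l2dot g h.
Proof. by rewrite ![l2dot _ h]l2dotC l2dotDr. Qed.

Lemma l2dotZl a f g : l2dot (a *: f) g = a * l2dot f g.
Proof. by rewrite ![l2dot _ g]l2dotC l2dotZr. Qed.

Lemma l2dot_ge0 f : 0 <= l2dot f f.
Proof. by apply: le_trans (fsum_le_l2dot f fset0); rewrite /fsum big_nil. Qed.

Lemma l2_cauchy_schwarz f g : l2dot f g ^+ 2 <= l2dot f f * l2dot g g.
Proof.
have [->|g0] := eqVneq g 0.
  by rewrite -(scale0r 0) !l2dotZr !mul0r expr0n mulr0.
have gg := l2dot_gt0 g0.
(* This is [l2dot g g] times the component of [f] orthogonal to [g]; its square is [l2dot g g] times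
   the difference of the two sides of the claim. *)
have := l2dot_ge0 (l2dot g g *: f + (- l2dot f g) *: g).
rewrite !(l2dotDl, l2dotDr, l2dotZl, l2dotZr) (l2dotC g f) => H.
rewrite -subr_ge0 -(pmulr_rge0 _ gg); apply: le_trans H _.
by rewrite le_eqVlt; apply/orP; left; apply/eqP; ring.
Qed.

Definition l2norm f : R := Num.sqrt (l2dot f f).

Lemma sqr_l2norm f : l2norm f ^+ 2 = l2dot f f.
Proof. by rewrite sqr_sqrtr// l2dot_ge0. Qed.

Lemma l2norm_ge0 f : 0 <= l2norm f. Proof. exact: sqrtr_ge0. Qed.

Fact ler_l2normD f g : l2norm (f + g) <= l2norm f + l2norm g.
Proof.
rewrite -(@ler_pXn2r _ 2)// ?nnegrE ?addr_ge0 ?l2norm_ge0//.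
rewrite sqrrD !sqr_l2norm !(l2dotDl, l2dotDr) (l2dotC g f).
have : l2dot f g <= l2norm f * l2norm g.
  rewrite (le_trans (ler_norm _))//.
  rewrite -(@ler_pXn2r _ 2)// ?nnegrE ?mulr_ge0 ?l2norm_ge0//.
  by rewrite real_normK ?num_real// exprMn !sqr_l2norm l2_cauchy_schwarz.
by move=> H; lra.
Qed.

Fact l2normZ (a : R) f : l2norm (a *: f) = `|a| * l2norm f.
Proof.
by rewrite /l2norm l2dotZl l2dotZr mulrA -expr2 sqrtrM ?sqr_ge0// sqrtr_sqr.
Qed.

Fact l2norm0_eq0 f : l2norm f = 0 -> f = 0.
Proof.
move=> f0; apply: contra_eq (f0) => /l2dot_gt0; rewrite -sqr_l2norm.
by move=> /lt0r_neq0; rewrite expf_eq0.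
Qed.

HB.instance Definition _ :=
  Lmodule_isNormed.Build R (l2 R J) ler_l2normD l2normZ l2norm0_eq0.

Lemma l2_normE f : `|f| = l2norm f. Proof. by []. Qed.

Lemma coord_le_l2norm f j : `|f j| <= `|f|.
Proof.
rewrite -(@ler_pXn2r _ 2)// ?nnegrE// real_normK ?num_real//.
by rewrite l2_normE sqr_l2norm sqr_le_l2dot.
Qed.

(** A Cauchy filter converges in each coordinate because coordinates are contractive. Bounds on
    finite partial sums survive the coordinatewise limit, which gives both membership of the limit
    in the space and convergence in norm. *)
Lemma l2_cauchy_cvg (F : set_system (l2 R J)) :
  ProperFilter F -> cauchy F -> cvg F.
Proof.
move=> FF /cauchy_ballP Fc.
have Fnear (eps : R) : 0 < eps ->
    exists2 A : set (l2 R J), F A & forall f g, A f -> A g -> `|f - g| <= eps.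
  move=> eps0; have [[A B] /= [FA FB] AB] := Fc _ eps0.
  exists (A `&` B); first exact: filterI.
  move=> f g [fA _] [_ gB]; apply: ltW.
  by have := AB (f, g) (conj fA gB); rewrite -ball_normE.
have coord_cvg j : cvg ((fun f : l2 R J => f j) @ F).
  apply: R_complete; apply/cauchy_ballP => eps eps0.
  have [A FA hA] := Fnear (eps / 2) ltac:(lra).
  pose cA := (fun f : l2 R J => f j) @` A.
  have FcA : F [set f | cA (f j)] by apply: filterS FA => f Af; exists f.
  exists (cA, cA); first by split; exact: FcA.
  move=> [_ _] /= [[f Af <-] [g Ag <-]]; rewrite /ball/=.
  have := le_trans (coord_le_l2norm (f - g) j) (hA _ _ Af Ag).
  rewrite (_ : (f - g) j = f j - g j)//; lra.
pose g j := lim ((fun f : l2 R J => f j) @ F).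
(* With [f] and the finite set [B] fixed, the second argument [h] runs along the filter to [g]. *)
have tail (eps : R) (A : set (l2 R J)) : 0 < eps -> F A ->
    (forall f h, A f -> A h -> `|f - h| <= eps) ->
    forall f B, A f -> fsum (fun j => (f j - g j) ^+ 2) B <= eps ^+ 2.
  move=> eps0 FA hA f B Af.
  have cg : (fun h : l2 R J => fsum (fun j => (f j - h j) ^+ 2) B) @ F -->
      fsum (fun j => (f j - g j) ^+ 2) B.
    apply: cvg_big => [|j _]; first exact: add_continuous.
    by apply: cvgM; apply: cvgB; (exact: cvg_cst || exact: coord_cvg).
  apply: (cvgr_to_le cg); apply: filterS FA => h Ah.
  apply: le_trans (fsum_le_l2dot (f - h) B) _.
  by rewrite -sqr_l2norm -l2_normE ler_pXn2r// ?nnegrE// ?hA// ltW.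
(* The limit is [f - (f - g)] for an [f] in a set of diameter at most 1, and [tail] bounds
   [f - g]. *)
have gP : g \in @square_summable R J.
  have [A FA hA] := Fnear _ (@ltr01 R).
  have [f Af] := filter_ex FA.
  have fgP : (fun j => f j - g j) \in @square_summable R J.
    by apply/asboolP; exists (1 ^+ 2) => B; exact: (tail _ A).
  have -> : g = (l2_fun f - (fun j => f j - g j)).
    by apply/funext => j; rewrite !fctE opprB addrC subrK.
  by apply: rpredB => //; exact: l2_funP.
apply/cvg_ex; exists (L2 gP); apply/cvgrPdist_le => eps eps0.
have [A FA hA] := Fnear _ eps0.
apply: (filterS _ (FA)) => f Af.
rewrite distrC -(@ler_pXn2r _ 2)// ?nnegrE// ?(ltW eps0)//.

rewrite l2_normE sqr_l2norm; apply: l2dot_le => B.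
by have := tail eps A eps0 FA hA f B Af.
Qed.

HB.instance Definition _ := Uniform_isComplete.Build (l2 R J) l2_cauchy_cvg.

Fact l2dot_norm f : l2dot f f = `|f| ^+ 2.
Proof. by rewrite l2_normE sqr_l2norm. Qed.

Definition l2_hilbert : hilbertType R :=
  @HilbertType R (l2 R J) (@l2dot R J) l2dot_norm.

End L2Hilbert.

(** * The Hahn-Banach theorem *)

Section HahnBanach.
Variables (R : realType) (W : lmodType R).
Implicit Types (p q : W -> R) (x y : W).

(** Homogeneity is asked as an inequality only, the form in which infima deliver it; using it at
    [a^-1] as well gives equality. *)
Definition sublinear p : Prop :=
  (forall x y, p (x + y) <= p x + p y) /\
  (forall (a : R) x, 0 < a -> p (a *: x) <= a * p x).

Lemma sublinearZ p (a : R) x : sublinear p -> 0 < a -> p (a *: x) = a * p x.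
Proof.
move=> [_ pZ] a0; apply/eqP; rewrite eq_le pZ//=.
have := pZ a^-1 (a *: x); rewrite invr_gt0 => /(_ a0).
by rewrite scalerA mulVf ?gt_eqF// scale1r ler_pdivlMl.
Qed.

Lemma sublinear0 p : sublinear p -> p 0 = 0.
Proof. by move=> /(sublinearZ 0)/(_ (ltr0n R 2)); rewrite scaler0; lra. Qed.

Lemma sublinear_opp p x : sublinear p -> - p (- x) <= p x.
Proof.
move=> sp; have := sp.1 x (- x); rewrite subrr sublinear0//; lra.
Qed.

(** Common source of the three sublinear functionals built as infima: [lower_at], the lower bound of
    a chain, and the order-unit functional of the cone. *)
Lemma inf_sublinear (D : W -> set R) :
  (forall x, has_inf (D x)) ->
  (forall x y t u, D x t -> D y u -> exists2 r, D (x + y) r & r <= t + u) ->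
  (forall (a : R) x t, 0 < a -> D x t -> exists2 r, D (a *: x) r & r <= a * t) ->
  sublinear (fun x => inf (D x)).
Proof.
move=> Dinf DD DZ.
have infle x t : D x t -> inf (D x) <= t.
  by move=> Dt; apply: ge_inf => //; have [] := Dinf x.
split=> [x y|a x a0].
  rewrite -lerBlDr; apply: lb_le_inf; first by have [] := Dinf x.
  move=> t Dt; rewrite lerBlDr -lerBlDl.
  apply: lb_le_inf; first by have [] := Dinf y.
  move=> u Du; rewrite lerBlDl.
  by have [r /infle] := DD _ _ _ _ Dt Du; exact: le_trans.
rewrite -ler_pdivrMl//; apply: lb_le_inf; first by have [] := Dinf x.
move=> t Dt; rewrite ler_pdivrMl//.
by have [r /infle] := DZ _ _ _ a0 Dt; exact: le_trans.
Qed.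

(* The largest sublinear functional below [q] that is at most [- q y] at [- y]. *)
Definition lower_at q y x : R :=
  inf [set r | exists2 t, 0 <= t & r = q (x + t *: y) - t * q y].

(** The lower bound [- q (- x)] comes from [t * q y = q (t *: y) <= q (x + t *: y) + q (- x)]. *)
Lemma has_inf_lower_at q y x : sublinear q ->
  has_inf [set r | exists2 t, 0 <= t & r = q (x + t *: y) - t * q y].
Proof.
move=> sq; split; first by exists (q (x + 0 *: y) - 0 * q y); exists 0.
exists (- q (- x)) => _ [t t0 ->].
have := sq.1 (x + t *: y) (- x); rewrite [_ + _ - x]addrC addKr.
have -> : q (t *: y) = t * q y.
  move: t0; rewrite le_eqVlt => /orP[/eqP<-|]; last exact: sublinearZ.
  by rewrite scale0r mul0r sublinear0.
lra.
Qed.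

Lemma sublinear_lower_at q y : sublinear q -> sublinear (lower_at q y).
Proof.
move=> sq; apply: inf_sublinear =>
  [x|x1 x2 _ _ [t t0 ->] [u u0 ->]|a x _ a0 [t t0 ->]].
- exact: has_inf_lower_at.
- exists (q (x1 + x2 + (t + u) *: y) - (t + u) * q y).
    by exists (t + u) => //; rewrite addr_ge0.
  have := sq.1 (x1 + t *: y) (x2 + u *: y).
  by rewrite addrACA -scalerDl; lra.
- exists (q (a *: x + (a * t) *: y) - (a * t) * q y).
    by exists (a * t) => //; rewrite mulr_ge0// ltW.
  by rewrite -scalerA -scalerDr sublinearZ// mulrBr mulrA.
Qed.

Lemma lower_at_le q y x : sublinear q -> lower_at q y x <= q x.
Proof.
move=> sq; apply: ge_inf; first by have [] := has_inf_lower_at y x sq.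
by exists 0 => //; rewrite scale0r addr0 mul0r subr0.
Qed.

Lemma lower_at_opp q y : sublinear q -> lower_at q y (- y) <= - q y.
Proof.
move=> sq; apply: ge_inf; first by have [] := has_inf_lower_at y (- y) sq.
by exists 1 => //; rewrite scale1r addNr sublinear0// mul1r add0r.
Qed.

(* A minimal sublinear functional is not lowered by [lower_at], hence is odd. *)
Lemma minimal_sublinear p : sublinear p ->
  exists2 q, sublinear q /\ (forall x, q x <= p x) &
    forall x, q (- x) = - q x.
Proof.
move=> sp; pose T := {q | sublinear q /\ forall x, q x <= p x}.
(* The order is reversed, so that a maximal element for Zorn's lemma is a minimal functional. *)
pose le_fun (q r : T) := `[< forall x, sval r x <= sval q x >].
have [||F Ftot|[q [sq qp]] qmin] :=
  @ZL_preorder T (exist _ p (conj sp (fun=> lexx _))) le_fun.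
- by move=> q; apply/asboolP.
- move=> q r s /asboolP qr /asboolP rs; apply/asboolP => x.
  exact: le_trans (rs x) (qr x).
- have [[q0 F0]|Fempty] := pselect (exists q : T, F q); last first.
    exists (exist _ p (conj sp (fun=> lexx _))) => q Fq.
    by exfalso; apply: Fempty; exists q.
  pose D x := (fun q : T => sval q x) @` F.
  have Dinf x : has_inf (D x).
    split; first by exists (sval q0 x); exists q0.
    exists (- p (- x)) => _ [[q [sq qp]] Fq <-] /=.
    by apply: le_trans (sublinear_opp x sq); rewrite lerN2.
  have infle x (q : T) : F q -> inf (D x) <= sval q x.
    by move=> Fq; apply: ge_inf; [have [] := Dinf x | exists q].
  (* Given two members of the chain, the smaller one serves at both points, which yields
     subadditivity of the infimum. *)
  have sD : sublinear (fun x => inf (D x)).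
    apply: inf_sublinear => // [x y _ _ [q Fq <-] [r Fr <-]|a x _ a0 [q Fq <-]].
      have [/asboolP qr|/asboolP rq] := Ftot _ _ Fq Fr.
        exists (sval r (x + y)); first by exists r.
        by apply: le_trans ((svalP r).1.1 x y) _; rewrite lerD2r.
      exists (sval q (x + y)); first by exists q.
      by apply: le_trans ((svalP q).1.1 x y) _; rewrite lerD2l.
    exists (sval q (a *: x)); first by exists q.
    exact: (svalP q).1.2.
  have Dp x : inf (D x) <= p x by apply: le_trans (infle x q0 F0) ((svalP q0).2 x).
  exists (exist _ (fun x => inf (D x)) (conj sD Dp)) => q Fq.
  by apply/asboolP => x; exact: infle.
exists q; first by [].
move=> y.
have lp x : lower_at q y x <= p x by apply: le_trans (lower_at_le y x sq) (qp x).
have /(_ _)/asboolP :=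
  qmin (exist _ (lower_at q y) (conj (sublinear_lower_at y sq) lp)).
move=> /(_ _ (- y)) /= H.
have {}H : q (- y) <= lower_at q y (- y).
  by apply: H; apply/asboolP => x /=; exact: lower_at_le.
apply/eqP; rewrite eq_le (le_trans H (lower_at_opp y sq))/=.
by have := sublinear_opp y sq; lra.
Qed.

(** An odd sublinear functional is linear. Minimizing below [lower_at p x0] instead of [p] forces
    the value at [- x0] down to [- p x0], hence equality at [x0]. *)
Lemma hahn_banach p x0 : sublinear p ->
  exists s : {linear W -> R^o}, (forall x, s x <= p x) /\ s x0 = p x0.
Proof.
move=> sp.
have [q [sq qp] qN] := minimal_sublinear (sublinear_lower_at x0 sp).
have qD x y : q (x + y) = q x + q y.
  apply/eqP; rewrite eq_le sq.1/=.
  by have := sq.1 (- x) (- y); rewrite -opprD !qN; lra.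
have qZ (a : R) x : q (a *: x) = a * q x.
  have [a0|a0|->] := ltgtP a 0; last by rewrite scale0r mul0r sublinear0.
    by rewrite -[a]opprK scaleNr qN mulNr sublinearZ// oppr_gt0.
  exact: sublinearZ.
have ql : linear (q : W -> R^o) by move=> a x y; rewrite qD qZ.
pose s : {linear W -> R^o} := HB.pack (q : W -> R^o)
  (GRing.isLinear.Build _ _ _ _ (q : W -> R^o) ql).
have qlep x : q x <= p x by apply: le_trans (qp x) (lower_at_le x0 x sp).
exists s; split => //=; apply/eqP; rewrite eq_le qlep/=.
have := le_trans (qp (- x0)) (lower_at_opp x0 sp).
by rewrite qN; lra.
Qed.

End HahnBanach.

(** * Matrix cones and unital completely positive maps *)

Section PositiveDefinite.
Variable R : realType.

(** Symmetric Gaussian elimination: split off the first row and column, apply the induction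
    hypothesis to the Schur complement, and normalize the pivot. *)
Lemma posdef_congruent_id n (A : 'M[R]_n) : A^T = A ->
  (forall u : 'cV_n, u != 0 -> 0 < (u^T *m A *m u) 0 0) ->
  exists B : 'M[R]_n, B^T *m A *m B = 1%:M.
Proof.
elim: n A => [|n IHn] A Asym Apos.
  by exists 0; apply/matrixP => -[].
move: A Asym Apos; rewrite -[n.+1]/(1 + n)%N => A Asym Apos.
pose a := A 0 0; pose b := ursubmx A; pose D := drsubmx A.
have Ablock : A = block_mx a%:M b b^T D.
  rewrite -[LHS]submxK; congr block_mx.
    by rewrite [LHS]mx11_scalar !mxE lshift0.
  by rewrite /b trmx_ursub Asym.
have a0 : 0 < a.
  have := Apos (delta_mx 0 0).
  rewrite trmx_delta -rowE -colE !mxE; apply.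
  by apply/eqP => /matrixP/(_ 0 0)/eqP; rewrite !mxE !eqxx oner_eq0.
have DT : D^T = D by rewrite /D trmx_drsub Asym.
(* The column operation that clears [b]; [S] is the Schur complement it leaves. *)
pose P : 'M[R]_(1 + n) := block_mx 1%:M (- (a^-1 *: b)) 0 1%:M.
pose S := D - a^-1 *: (b^T *m b).
have PAP : P^T *m A *m P = block_mx a%:M 0 0 S.
  rewrite Ablock /P tr_block_mx !mulmx_block !trmx1 trmx0.
  rewrite !(mul1mx, mulmx1, mul0mx, mulmx0, addr0, add0r).
  have bT : (- (a^-1 *: b))^T = - (a^-1 *: b^T) by rewrite linearN linearZ.
  rewrite bT; have ab : a%:M *m - (a^-1 *: b) + b = 0.
    by rewrite mulmxN mul_scalar_mx scalerA mulfV ?gt_eqF// scale1r addNr.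
  have ba : - (a^-1 *: b^T) *m a%:M + b^T = 0.
    by rewrite mulNmx mul_mx_scalar scalerA mulfV ?gt_eqF// scale1r addNr.
  rewrite ab ba mul0mx add0r; congr block_mx.
  by rewrite /S mulNmx -scalemxAl addrC.
have congP m (w : 'M[R]_(1 + n, m)) :
    (P *m w)^T *m A *m (P *m w) = w^T *m block_mx a%:M 0 0 S *m w.
  by rewrite -PAP trmx_mul !mulmxA.
have [|v v0|B' B'P] := IHn S.
- by rewrite /S linearB /= linearZ /= trmx_mul trmxK DT.
(* On this vector the form of [A] equals the form of [S] at [v]. *)
- have := Apos (P *m col_mx 0 v).
  rewrite congP tr_col_mx mul_row_block mul_row_col trmx0.
  rewrite !(mul0mx, mulmx0, add0r); apply.
  apply: contra v0 => /eqP; rewrite /P mul_block_col !(mul1mx, mul0mx, mulmx0, add0r).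
  by rewrite -[0]col_mx0 => /eq_col_mx[_ ->].
pose c := (Num.sqrt a)^-1.
exists (P *m block_mx c%:M 0 0 B').
rewrite congP tr_block_mx !mulmx_block !trmx0 !(mul0mx, mulmx0, add0r, addr0).
rewrite B'P tr_scalar_mx -!scalar_mxM.
rewrite (_ : c * a * c = 1) -?scalar_mx_block//.
have sa : Num.sqrt a ^+ 2 = a by rewrite sqr_sqrtr// ltW.
by rewrite /c -{2}sa; field; rewrite gt_eqF// sqrtr_gt0.
Qed.

End PositiveDefinite.

(** * Arithmetic of the matrix cones *)

Section MatrixCones.
Variables (R : realType) (V : lmodType R) (star : {linear V -> V}).
Variables (C : forall n, set 'M[V]_n) (e : V).
Arguments C : clear implicits.
Hypothesis hV : real_operator_system star C e.

Local Notation eunit n := (mxdiag_of e n).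
Local Notation scalemx t := (map_mx ( *:%R t)).

Lemma mxcompress_col_mx n m p (a : 'M[R]_(n, p)) (b : 'M[R]_(m, p))
    (x : 'M[V]_n) (y : 'M[V]_m) :
  mxcompress (col_mx a b) (block_mx x 0 0 y) = mxcompress a x + mxcompress b y.
Proof.
apply/matrixP => i j; rewrite !mxE big_split_ord /=; congr (_ + _).
  apply: eq_bigr => k _; rewrite big_split_ord /= [X in _ + X]big1 ?addr0.
    by apply: eq_bigr => l _; rewrite block_mxEul !col_mxEu.
  by move=> l _; rewrite block_mxEur [X in _ *: X]mxE scaler0.
apply: eq_bigr => k _; rewrite big_split_ord /= [X in X + _]big1 ?add0r.
  by apply: eq_bigr => l _; rewrite block_mxEdr !col_mxEd.
by move=> l _; rewrite block_mxEdl [X in _ *: X]mxE scaler0.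
Qed.

Lemma mxcompress_scalar n (a : R) (x : 'M[V]_n) :
  mxcompress a%:M x = scalemx (a ^+ 2) x.
Proof.
apply/matrixP => i j; rewrite !mxE (bigD1 i)//= (bigD1 j)//= !mxE !eqxx !mulr1n.
rewrite big1 ?addr0 => [|l lj]; last by rewrite !mxE (negPf lj) mulr0n mulr0 scale0r.
rewrite big1 ?addr0// => k ki; rewrite big1// => l _.
by rewrite !mxE (negPf ki) mulr0n mul0r scale0r.
Qed.

Lemma cone0 n : (0 < n)%N -> C n 0.
Proof.
move=> n0; have := ros_proper hV n0.
by move=> /seteqP[_ /(_ 0 erefl)[]].
Qed.

Lemma cone_compress n m (a : 'M[R]_(n, m)) (x : 'M[V]_n) :
  (0 < n)%N -> (0 < m)%N -> C n x -> C m (mxcompress a x).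
Proof.
by move=> n0 m0 Cx; apply: (rmo_compress (ros_ordering hV) n0 m0); exists x.
Qed.

(** The axioms give only direct sums and compressions: the sum is the compression of the direct sum
    by two stacked identity matrices. *)
Lemma coneD n (x y : 'M[V]_n) : (0 < n)%N -> C n x -> C n y -> C n (x + y).
Proof.
move=> n0 Cx Cy.
have -> : x + y = mxcompress (col_mx 1%:M 1%:M) (block_mx x 0 0 y).
  rewrite mxcompress_col_mx !mxcompress_scalar expr1n.
  by congr (_ + _); apply/matrixP => i j; rewrite mxE scale1r.
apply: cone_compress; rewrite ?addn_gt0 ?n0//.
exact: (rmo_oplus (ros_ordering hV)).
Qed.

(** Scaling by [t] is compression by the scalar matrix of its square root. *)
Lemma coneZ n (x : 'M[V]_n) (t : R) :
  (0 < n)%N -> 0 <= t -> C n x -> C n (scalemx t x).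
Proof.
move=> n0 t0 Cx; rewrite -(sqr_sqrtr t0) -mxcompress_scalar.
exact: cone_compress.
Qed.

Lemma cone_sa n (x : 'M[V]_n) : (0 < n)%N -> C n x -> mxstar star x = x.
Proof. by move=> n0; exact: (rmo_sa (ros_ordering hV)). Qed.

Lemma scalemxA n (s t : R) (x : 'M[V]_n) :
  scalemx s (scalemx t x) = scalemx (s * t) x.
Proof. by apply/matrixP => i j; rewrite !mxE scalerA. Qed.

Lemma scalemxDl n (s t : R) (x : 'M[V]_n) :
  scalemx (s + t) x = scalemx s x + scalemx t x.
Proof. by apply/matrixP => i j; rewrite !mxE scalerDl. Qed.

Lemma scalemxBr n (s : R) (x y : 'M[V]_n) :
  scalemx s (x - y) = scalemx s x - scalemx s y.
Proof. by apply/matrixP => i j; rewrite !mxE scalerBr. Qed.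

Lemma scale1mx n (x : 'M[V]_n) : scalemx 1 x = x.
Proof. by apply/matrixP => i j; rewrite !mxE scale1r. Qed.

Lemma scale0mx n (x : 'M[V]_n) : scalemx 0 x = 0.
Proof. by apply/matrixP => i j; rewrite !mxE scale0r. Qed.

Lemma scaleN1mx n (x : 'M[V]_n) : scalemx (-1) x = - x.
Proof. by apply/matrixP => i j; rewrite !mxE scaleN1r. Qed.

(** The order unit property at the zero matrix puts some positive multiple of the unit in the cone;
    the rest is rescaling. *)
Lemma cone_eunit n (t : R) : (0 < n)%N -> 0 <= t -> C n (scalemx t (eunit n)).
Proof.
move=> n0 t0.
have sa0 : mxsa star (0 : 'M[V]_n).
  by apply/matrixP => i j; rewrite !mxE linear0.
have [r r0 Cr] := ros_order_unit hV n0 sa0.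
rewrite addr0 in Cr; have -> : t = (t / r) * r by rewrite mulfVK ?gt_eqF.
by rewrite -scalemxA; apply: coneZ => //; rewrite divr_ge0// ltW.
Qed.

(** A negative [t] would put both signs of the unit in the cone, so the unit would vanish by
    properness, and the order unit property would then put [x] itself in the cone. *)
Lemma cone_eunit_ge0 n (t : R) (x : 'M[V]_n) : (0 < n)%N ->
  mxstar star x = x -> ~ C n x -> C n (scalemx t (eunit n)) -> 0 <= t.
Proof.
move=> n0 xsa nCx Ct; rewrite leNgt; apply/negP => t0; apply: nCx.
have CN : C n (- eunit n).
  rewrite -scaleN1mx (_ : -1 = (- t^-1) * t); last first.
    by rewrite mulNr mulVf ?lt_eqF.
  by rewrite -scalemxA; apply: coneZ => //; rewrite oppr_ge0 invr_le0 ltW.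
have Cp : C n (eunit n) by rewrite -(scale1mx (eunit n)); exact: cone_eunit.
have e0 : eunit n = 0.
  have /seteqP[H _] := ros_proper hV n0; apply: H; split => //.
  by exists (- eunit n) => //; rewrite opprK.
have [r r0] := ros_order_unit hV n0 xsa.
rewrite e0; congr (C _); apply/matrixP => i j.
by rewrite !mxE scaler0 add0r.
Qed.

(** * Functionals separating a selfadjoint matrix from the cone *)

Section Separation.
Variable n : nat.
Hypothesis n0 : (0 < n)%N.

(* ['M[V]_n] carries no module structure, so functionals live on functions. *)
Local Notation W := ('I_n -> 'I_n -> V).

Definition mx_of_fun (w : W) : 'M[V]_n := \matrix_(i, j) w i j.

(** Twice the selfadjoint part; hence the factor 2 at selfadjoint matrices. *)
Definition symmx (w : W) : 'M[V]_n := mx_of_fun w + mxstar star (mx_of_fun w).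

Lemma fun_of_matrixK (x : 'M[V]_n) : mx_of_fun x = x.
Proof. by apply/matrixP => i j; rewrite mxE. Qed.

Lemma symmxD w1 w2 : symmx (w1 + w2) = symmx w1 + symmx w2.
Proof. by apply/matrixP => i j; rewrite !mxE linearD addrACA. Qed.

Lemma symmxZ (a : R) w : symmx (a *: w) = scalemx a (symmx w).
Proof. by apply/matrixP => i j; rewrite !mxE linearZ /= scalerDr. Qed.

Lemma symmxN w : symmx (- w) = - symmx w.
Proof. by rewrite -scaleN1r symmxZ scaleN1mx. Qed.

Lemma symmx_fun (x : 'M[V]_n) : mxstar star x = x -> symmx x = scalemx 2 x.
Proof.
move=> xsa; rewrite /symmx fun_of_matrixK xsa.
by rewrite -{1 2}(scale1mx x) -scalemxDl -natr1.
Qed.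

Lemma symmx_sa w : mxstar star (symmx w) = symmx w.
Proof.
apply/matrixP => i j; rewrite !mxE linearD addrC.
by rewrite (ros_involution hV).
Qed.

Lemma cone_separation (x : 'M[V]_n) : mxstar star x = x -> ~ C n x ->
  exists s : {linear W -> R^o},
    [/\ forall y : 'M[V]_n, C n y -> 0 <= s y,
        forall w : W, s (fun i j => star (w j i)) = s w & s x < 0].
Proof.
move=> xsa nCx.
pose D (w : W) := [set t : R | C n (scalemx t (eunit n) - symmx w)].
pose p (w : W) := inf (D w).
have Dinf w : has_inf (D w).
  have sNw : mxsa star (symmx (- w)) by exact: symmx_sa.
  have [t t0 Ct] := ros_order_unit hV n0 sNw.
  have [u u0 Cu] := ros_order_unit hV n0 (symmx_sa w).
  split; first by exists t; rewrite /D /= -symmxN.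
  (* Adding the members for [r] and [u] leaves [r + u] times the unit in the cone; as [x] lies
     outside the cone, [r + u] is nonnegative. *)
  exists (- u) => r /= Cr.
  rewrite -subr_ge0 opprK; apply: (cone_eunit_ge0 n0 xsa nCx).
  by rewrite scalemxDl -[X in C n X](addrNK (symmx w)) -addrA addrACA; exact: coneD.
have infle w t : D w t -> p w <= t by move=> ?; apply: ge_inf => //; case: (Dinf w).
have psub : sublinear p.
  apply: inf_sublinear => // [w1 w2 t u Dt Du|a w t a0 Dt].
    exists (t + u) => //; rewrite /D /= scalemxDl symmxD opprD addrACA.
    exact: coneD.
  exists (a * t) => //; rewrite /D /= symmxZ.
  rewrite (_ : _ - _ = scalemx a (scalemx t (eunit n) - symmx w)).
    by apply: coneZ => //; exact: ltW.
  by rewrite scalemxBr scalemxA.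
(* Equality with [p] is requested at [- x], so [s x = - p (- x)]; the archimedean axiom will make
   [p (- x)] positive. *)
have [s [sp sx]] := hahn_banach (- (x : W)) psub.
exists s; split.
- move=> y Cy; rewrite -oppr_le0 -linearN; apply: le_trans (sp _) _; apply: infle.
  rewrite /D /= symmxN opprK symmx_fun ?(cone_sa n0)// scale0mx add0r.
  exact: coneZ.
(* The argument has zero selfadjoint part, so [p] is at most 0 there; exchanging [w] with its
   adjoint gives the opposite inequality. *)
- have anti w : s (w - (fun i j => star (w j i))) <= 0.
    apply: le_trans (sp _) _; apply: infle; rewrite /D /= scale0mx add0r.
    rewrite (_ : symmx _ = 0) ?oppr0; first exact: cone0.
    apply/matrixP => i j; rewrite !mxE /= linearB (ros_involution hV) /=.
    by rewrite addrA subrK subrr.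
  move=> w; apply/eqP; rewrite eq_le; apply/andP; split; rewrite -subr_le0.
    have := anti (fun i j => star (w j i)); rewrite linearB /=.
    congr (_ - s _ <= _); apply/funext => i; apply/funext => j.
    by rewrite (ros_involution hV).
  by have := anti w; rewrite linearB.
- have Nx2 : ~ C n (scalemx 2 x).
    move=> C2; apply: nCx; rewrite -(scale1mx x) -(@mulVf _ 2)// -scalemxA.
    by apply: coneZ => //; rewrite invr_ge0.
  have [t t0 nCt] : exists2 t, 0 < t & ~ C n (scalemx t (eunit n) + scalemx 2 x).
    apply: contrapT => H; apply: Nx2; apply: (ros_archimedean hV n0).
      apply/matrixP => i j; rewrite !mxE linearZ /=; congr (_ *: _).
      by move/matrixP: xsa => /(_ i j); rewrite !mxE.
    by move=> t t0; apply: contrapT => nC; apply: H; exists t.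
  rewrite -oppr_gt0 -linearN sx (lt_le_trans t0)//.
  apply: lb_le_inf; first by case: (Dinf (- (x : W))).
  move=> r; rewrite /D /= symmxN opprK symmx_fun// => Cr.
  (* If [r < t], adding [t - r] times the unit would bring the matrix for [t] into the cone. *)
  rewrite leNgt; apply/negP => rt; apply: nCt.
  rewrite -(subrK r t) scalemxDl -addrA; apply: coneD => //.
  by apply: cone_eunit => //; rewrite subr_ge0 ltW.
Qed.

(** Moving a diagonal entry to another diagonal place is a compression, hence preserves the cone;
    the perturbing functional [T] is nonnegative for this reason. *)
Lemma mxcompress_delta (i a : 'I_n) (x : 'M[V]_n) :
  mxcompress (delta_mx i a) x = \matrix_(k, l) (x i i *+ ((k == a) && (l == a))).
Proof.
apply/matrixP => k l; rewrite !mxE (bigD1 i)//= [X in _ + X]big1 ?addr0 => [|p pi].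
  rewrite (bigD1 i)//= [X in _ + X]big1 ?addr0 => [|q qi]; rewrite !mxE ?eqxx.
    by rewrite -natrM mulnb scaler_nat.
  by rewrite (negPf qi) /= mulr0 scale0r.
by rewrite big1// => q _; rewrite !mxE (negPf pi) mul0r scale0r.
Qed.

(* Adding a small multiple of [w |-> \sum_(i, a) s (E_aa (w i i))] to [s] makes
   it definite on matrices of multiples of [e]. *)
Lemma cone_separation_posdef (x : 'M[V]_n) : mxstar star x = x -> ~ C n x ->
  exists s : {linear W -> R^o},
    [/\ forall y : 'M[V]_n, C n y -> 0 <= s y,
        forall w : W, s (fun i j => star (w j i)) = s w,
        s x < 0 &
        forall u : 'I_n -> R, (exists i, u i != 0) ->
          0 < s (fun i j => (u i * u j) *: e)].
Proof.
move=> xsa nCx; have [s [s_ge0 s_star sx]] := cone_separation xsa nCx.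
pose tr v : R := \sum_(a < n) s (fun k l => v *+ ((k == a) && (l == a))).
have tr_lin : linear (tr : V -> R^o).
  move=> c v1 v2; rewrite /tr scaler_sumr -big_split; apply: eq_bigr => a _ /=.
  rewrite -linearZ -linearD; congr (s _); apply/funext => k; apply/funext => l.
  by rewrite !fctE -scalerMnr -mulrnDl.
have trZ c v : tr (c *: v) = c * tr v.
  rewrite /tr mulr_sumr; apply: eq_bigr => a _.
  rewrite -[RHS]linearZ; congr (s _); apply/funext => k; apply/funext => l.
  by rewrite !fctE scalerMnr.
have tr_star v : tr (star v) = tr v.
  apply: eq_bigr => a _; rewrite -[RHS]s_star; congr (s _).
  by apply/funext => k; apply/funext => l; rewrite raddfMn andbC.
(* Some [t e_n + x] with [t > 0] lies in the cone, so [t * s (e_n) >= - s x > 0]. *)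
have tr_e : 0 < tr e.
  have se : s (eunit n) = tr e.
    rewrite /tr -linear_sum; congr (s _); apply/funext => k; apply/funext => l.
    rewrite !fct_sumE mxE (bigD1 k)//= eqxx big1 ?addr0 => [|a ak].
      by rewrite andTb eq_sym.
    by rewrite eq_sym (negPf ak).
  have [t t0 /s_ge0] := ros_order_unit hV n0 xsa.
  rewrite (_ : fun_of_matrix _ = t *: (eunit n : W) + (x : W)); last first.
    by apply/funext => i; apply/funext => j; rewrite !fctE !mxE. 
  rewrite linearD linearZ /= se => H.
  rewrite -(pmulr_rgt0 _ t0) -oppr_lt0; apply: le_lt_trans sx.
  by rewrite -subr_ge0 opprK addrC.
pose T w : R := \sum_(i < n) tr (w i i).
have T_lin : linear (T : W -> R^o).
  move=> c w1 w2; rewrite /T scaler_sumr -big_split; apply: eq_bigr => i _ /=.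
  by rewrite !fctE tr_lin.
have T_ge0 (y : 'M[V]_n) : C n y -> 0 <= T y.
  move=> Cy; apply: sumr_ge0 => i _; apply: sumr_ge0 => a _.
  have := s_ge0 _ (cone_compress (delta_mx i a) n0 n0 Cy).
  rewrite mxcompress_delta; congr (_ <= s _).
  by apply/funext => k; apply/funext => l; rewrite mxE.
(* Small enough that [eps * T x <= - s x / 2], which keeps the perturbed value at [x] negative. *)
pose eps := (- s x) / (1 + `|T x|) / 2.
have d0 : 0 < 1 + `|T x| by rewrite ltr_pwDl.
have eps0 : 0 < eps by rewrite !divr_gt0// oppr_gt0.
have s'_lin : linear (fun w : W => s w + eps * T w : R^o).
  move=> c w1 w2; rewrite linearD linearZ /= T_lin /GRing.scale /=; ring.
pose s' : {linear W -> R^o} := HB.pack (fun w : W => s w + eps * T w : R^o)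
  (GRing.isLinear.Build _ _ _ _ _ s'_lin).
exists s'; split=> /=.
- by move=> y Cy; rewrite addr_ge0 ?s_ge0// mulr_ge0 ?T_ge0// ltW.
- move=> w; rewrite s_star /T; congr (_ + _ * _).
  by apply: eq_bigr => i _; exact: tr_star.
- have : eps * T x <= eps * (1 + `|T x|).
    by rewrite ler_pM2l// (le_trans (ler_norm _))// lerDr.
  have -> : eps * (1 + `|T x|) = (- s x) / 2.
    by rewrite /eps; field; rewrite gt_eqF.
  lra.
(* The matrix is the compression of the 1 by 1 unit by the row [u], so [s] is nonnegative on it; [T]
   contributes the sum of the [u i ^+ 2] times [tr e]. *)
- move=> u [i ui]; rewrite ltr_wpDl//.
    have Ce : C 1 (eunit 1) by rewrite -(scale1mx (eunit 1)); exact: cone_eunit.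
    have := s_ge0 _ (cone_compress (\row_j u j) isT n0 Ce).
    congr (_ <= s _); apply/funext => k; apply/funext => l.
    by rewrite !mxE !big_ord1 !mxE eqxx.
  rewrite pmulr_rgt0// /T (eq_bigr (fun i => u i ^+ 2 * tr e)) => [|j _]; last first.
    exact: trZ.
  rewrite -mulr_suml pmulr_lgt0// (bigD1 i)//= ltr_pwDl//.
    by rewrite exprn_even_gt0.
  by apply: sumr_ge0 => j _; exact: sqr_ge0.
Qed.

End Separation.

(** * Unital completely positive maps into real matrices *)

Lemma mulmx_row_col d (A : 'M[R]_d) (u v : 'rV[R]_d) :
  (u *m A *m v^T) 0 0 = \sum_i \sum_j u 0 i * A i j * v 0 j.
Proof.
rewrite exchange_big mxE; apply: eq_bigr => j _.
by rewrite !mxE mulr_suml.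
Qed.

(* <[f (y k l)] xi, xi>, the k-th component of xi being [row k xi] *)
Definition cpform d (f : V -> 'M[R]_d) m (xi : 'M[R]_(m, d)) (y : 'M[V]_m) : R :=
  \sum_k \sum_l (row k xi *m f (y k l) *m (row l xi)^T) 0 0.

(** A selfadjoint matrix for arbitrary [v], through which the second cone controls elements that are
    not selfadjoint. *)
Definition offdiag (v : V) : 'M[V]_(1 + 1) :=
  block_mx 0 (const_mx v) (const_mx (star v)) 0.

Lemma mxstar_offdiag (v : V) : mxstar star (offdiag v) = offdiag v.
Proof.
rewrite /mxstar /offdiag tr_block_mx map_block_mx; congr block_mx;
  by apply/matrixP => i j; rewrite !mxE ?linear0 ?(ros_involution hV).
Qed.

(** The dimension is a field, so maps into all matrix sizes form one index type. [ucp_pos] is the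
    quadratic form part of complete positivity; the symmetry part follows from [ucp_star]. *)
Record ucp_map := UcpMap {
  ucp_dim : nat;
  ucp_fun :> V -> 'M[R]_ucp_dim;
  ucp_linear : linear ucp_fun;
  ucp_star : forall v, ucp_fun (star v) = (ucp_fun v)^T;
  ucp_unit : ucp_fun e = 1%:M;
  ucp_pos : forall m, (0 < m)%N -> forall y : 'M[V]_m, C m y ->
    forall (xi : 'M[R]_(m, ucp_dim)), 0 <= cpform ucp_fun xi y }.

HB.instance Definition _ (f : ucp_map) :=
  GRing.isLinear.Build _ _ _ _ (ucp_fun f) (@ucp_linear f).

Lemma ucp_separation n (x : 'M[V]_n) : (0 < n)%N ->
  mxstar star x = x -> ~ C n x ->
  exists (f : ucp_map) (xi : 'M[R]_(n, ucp_dim f)), cpform f xi x < 0.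
Proof.
move=> n0 xsa nCx.
have [s [s_ge0 s_star sx s_pos]] := cone_separation_posdef n0 xsa nCx.
pose E i j (v : V) := fun k l : 'I_n => v *+ ((k == i) && (l == j)).
pose A v : 'M[R]_n := \matrix_(i, j) s (E i j v).
have E_linear i j c v w : E i j (c *: v + w) = c *: E i j v + E i j w.
  apply/funext => k; apply/funext => l.
  by rewrite !fctE /E -scalerMnr -mulrnDl.
have A_linear : linear A.
  by move=> c v w; apply/matrixP => i j; rewrite !mxE E_linear linearD linearZ.
have A_star v : A (star v) = (A v)^T.
  apply/matrixP => i j; rewrite !mxE -s_star; congr (s _).
  apply/funext => k; apply/funext => l.
  by rewrite /E raddfMn /= (ros_involution hV) andbC.
have E_sum (w : 'I_n -> 'I_n -> V) : w = \sum_i \sum_j E i j (w i j).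
  apply/funext => k; apply/funext => l; rewrite !fct_sumE.
  rewrite (bigD1 k)//= !fct_sumE (bigD1 l)//= /E !eqxx.
  rewrite big1 ?addr0 => [|j lj]; last by rewrite eq_sym (negPf lj).
  rewrite big1 ?addr0// => i ki; rewrite !fct_sumE big1// => j _.
  by rewrite eq_sym (negPf ki).
have sA w : s w = \sum_i \sum_j A (w i j) i j.
  rewrite [in LHS](E_sum w) linear_sum; apply: eq_bigr => i _.
  by rewrite linear_sum; apply: eq_bigr => j _; rewrite mxE.
pose A' : {linear V -> 'M[R]_n} :=
  HB.pack A (GRing.isLinear.Build _ _ _ _ A A_linear).
(* Each form of an amplification of [A] is [s] at a compression, so positivity of [s] becomes
   complete positivity of [A]. *)
have A_form m (xi : 'M[R]_(m, n)) (y : 'M[V]_m) :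
    cpform A xi y = s (mxcompress xi y).
  rewrite sA /cpform.
  under eq_bigr do under eq_bigr do rewrite mulmx_row_col.
  under eq_bigr do rewrite exchange_big.
  rewrite exchange_big; apply: eq_bigr => i _.
  under eq_bigr do rewrite exchange_big.
  rewrite exchange_big; apply: eq_bigr => j _.
  rewrite [mxcompress _ _ _ _]mxE -[A _]/(A' _) linear_sum summxE.
  apply: eq_bigr => k _.
  rewrite linear_sum summxE; apply: eq_bigr => l _.
  by rewrite linearZ [LHS]mulrAC ![row _ _ _ _]mxE [RHS]mxE.
have A_pos (u : 'rV[R]_n) :
    (u *m A e *m u^T) 0 0 = s (fun i j => (u 0 i * u 0 j) *: e).
  rewrite sA mulmx_row_col; apply: eq_bigr => i _; apply: eq_bigr => j _.
  by rewrite -[A (_ *: _)]/(A' _) linearZ [RHS]mxE mulrAC.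
have [|u u0|B BAB] := @posdef_congruent_id R n (A e).
- by rewrite -A_star (ros_unit_sa hV).
- rewrite -{2}[u]trmxK A_pos; apply: s_pos.
  apply: contrapT => H; case/eqP: u0; apply/colP => i; rewrite mxE.
  apply: contrapT => ui; apply: H; exists i; rewrite mxE; exact/eqP.
pose f v := B^T *m A v *m B.
have f_form m (xi : 'M[R]_(m, n)) (y : 'M[V]_m) :
    cpform f xi y = cpform A (xi *m B^T) y.
  apply: eq_bigr => k _; apply: eq_bigr => l _.
  by rewrite /f !row_mul trmx_mul trmxK !mulmxA.
have f_linear : linear f.
  by move=> c v w; rewrite /f A_linear mulmxDr mulmxDl -scalemxAr -scalemxAl.
have f_star v : f (star v) = (f v)^T.
  by rewrite /f A_star !trmx_mul trmxK mulmxA.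
have f_pos m : (0 < m)%N -> forall y : 'M[V]_m, C m y ->
    forall (xi : 'M[R]_(m, n)), 0 <= cpform f xi y.
  move=> m0 y Cy xi; rewrite f_form A_form; apply: s_ge0.
  exact: cone_compress.
(* This [xi] undoes the congruence: [xi *m B^T] is the identity, so the form at [x] is [s x]. *)
exists (UcpMap f_linear f_star BAB f_pos), (A e *m B).
rewrite f_form (_ : _ *m B^T = 1%:M); last by apply: mulmx1C; rewrite mulmxA.
rewrite A_form mxcompress_scalar expr1n.
by rewrite (_ : map_mx _ x = x)// scale1mx.
Qed.

(** The constant comes from the order unit alone, so it serves all maps [f] at once. Positivity of
    the 2 by 2 block matrix with diagonal [t] and corner [f v] bounds the norm of [f v] by [t]. *)
Lemma ucp_bounded (v : V) : exists2 t : R, 0 < t &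
  forall (f : ucp_map) (u : 'cV_(ucp_dim f)),
    ((f v *m u)^T *m (f v *m u)) 0 0 <= t ^+ 2 * (u^T *m u) 0 0.
Proof.
pose x := offdiag v.
have xsa : mxstar star x = x by exact: mxstar_offdiag.
have [t t0 Ct] := ros_order_unit hV (isT : (0 < 1 + 1)%N) xsa.
exists t => // f u; set w := f v *m u.
set y := _ + x in Ct.
pose i0 : 'I_(1 + 1) := lshift 1 0; pose i1 : 'I_(1 + 1) := rshift 1 0.
have yE k l : y k l = t *: (e *+ (k == l)) + x k l.
  by rewrite /y [LHS]mxE [map_mx _ _ _ _]mxE [mxdiag_of _ _ _ _]mxE.
have y00 : y i0 i0 = t *: e by rewrite yE eqxx /x block_mxEul mxE addr0.
have y11 : y i1 i1 = t *: e by rewrite yE eqxx /x block_mxEdr mxE addr0.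
have y01 : y i0 i1 = v by rewrite yE scaler0 add0r /x block_mxEur mxE.
have y10 : y i1 i0 = star v by rewrite yE scaler0 add0r /x block_mxEdl mxE.
(* the vector minimizing the form of [[t, f v], [(f v)^T, t]] over its first half *)
have := @ucp_pos f _ (isT : (0 < 1 + 1)%N) _ Ct (col_mx (- t^-1 *: w^T) u^T).
rewrite /cpform !big_split_ord /= !big_ord1 !big_split_ord /= !big_ord1.
rewrite -!/i0 -!/i1 y00 y11 y01 y10 !rowKu !rowKd !row_id.
have fte : f (t *: e) = t%:M by rewrite linearZ /= ucp_unit scalemx1.
have wT : u^T *m (f v)^T = w^T by rewrite -trmx_mul.
have trZ : (- t^-1 *: w^T)^T = - t^-1 *: w by rewrite linearZ /= trmxK.
rewrite fte ucp_star trZ !trmxK wT -[_ *m f v *m u]mulmxA -/w !mul_mx_scalar.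
rewrite -!(scalemxAl, scalemxAr) !scalerA.
set N := w^T *m w; set U := u^T *m u.
have Z00 (a : R) (M : 'M[R]_1) : (a *: M) 0 0 = a * M 0 0 by rewrite mxE.
rewrite !Z00.
have -> : t * (- t^-1) * (- t^-1) = t^-1 by field; rewrite gt_eqF.
move=> H; rewrite -subr_ge0.
have -> : t ^+ 2 * U 0 0 - N 0 0 =
    t * (t^-1 * N 0 0 + - t^-1 * N 0 0 + (- t^-1 * N 0 0 + t * U 0 0)).
  by field; rewrite gt_eqF.
by rewrite mulr_ge0// ltW.
Qed.

End MatrixCones.

(** * Block-diagonal operators *)

HB.instance Definition _ (R : realType) (H : hilbertType R)
    (T : bounded_operator H) :=
  GRing.isLinear.Build R H H *:%R (Defs.bounded_fun T)
    (asboolW (Defs.bounded_funP T)).1.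

Section BlockOperators.
Variables (R : realType) (I : choiceType) (d : I -> nat).

Local Notation J := {i : I & 'I_(d i)}.
Local Notation tag_ord i k := (Tagged (fun i : I => 'I_(d i)) (k : 'I_(d i))).

Definition blocks (S : {fset I}) : {fset J} :=
  seq_fset tt [seq tag_ord i k | i <- S, k <- enum 'I_(d i)].

Lemma fsum_blocks (g : J -> R) (S : {fset I}) :
  fsum g (blocks S) = \sum_(i <- S) \sum_k g (tag_ord i k).
Proof.
rewrite /fsum (perm_big _ (seq_fset_perm _ _)) undup_id /=; last first.
  rewrite allpairs_uniq_dep// => [i _|[i k] [i' k'] _ _]; last by [].
  exact: enum_uniq.
rewrite big_allpairs_dep; apply: eq_bigr => i _.
by rewrite big_enum.
Qed.

Lemma mem_blocks (S : {fset I}) (j : J) : (j \in blocks S) = (tag j \in S).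
Proof.
case: j => i k; rewrite seq_fsetE; apply/allpairsPdep/idP => /=.
  by move=> [i' [k' [Si' _ E]]]; move: Si'; have -> : i = i' by case: E.
by move=> Si; exists i, k; rewrite mem_enum.
Qed.

Lemma sub_blocks (A : {fset J}) : (A `<=` blocks [fset tag j | j in A])%fset.
Proof. by apply/fsubsetP => j Aj; rewrite mem_blocks; apply/imfsetP; exists j. Qed.

(** Unions of full blocks are cofinal among finite sets of coordinates, so limits may be taken block
    by block. *)
Lemma cvg_blocks : blocks @ totally --> totally.
Proof.
move=> P [A _ AP]; exists [fset tag j | j in A]%fset => // S AS.
apply: AP; apply: fsubset_trans (sub_blocks A) _.
by apply/fsubsetP => j; rewrite !mem_blocks; exact: (fsubsetP AS).
Qed.

Definition block_col (g : J -> R) (i : I) : 'cV[R]_(d i) := \col_k g (tag_ord i k).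

Lemma cvg_l2dot_blocks (g h : l2 R J) :
  (fun S : {fset I} => \sum_(i <- S) ((block_col g i)^T *m block_col h i) 0 0)
    @ totally --> l2dot g h.
Proof.
have := cvg_comp _ _ cvg_blocks (@cvg_l2dot _ _ g h).
apply: cvg_trans; apply: near_eq_cvg; apply: nearW => S /=.
rewrite fsum_blocks; apply: eq_bigr => i _; rewrite mxE; apply: eq_bigr => k _.
by rewrite !mxE.
Qed.

Implicit Type A : forall i, 'M[R]_(d i).

Definition block_bounded A : Prop := exists2 t : R, 0 < t &
  forall i (u : 'cV[R]_(d i)),
    ((A i *m u)^T *m (A i *m u)) 0 0 <= t ^+ 2 * (u^T *m u) 0 0.

Definition block_fun A (g : J -> R) (j : J) : R :=
  (A (tag j) *m block_col g (tag j)) (tagged j) 0.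

Lemma block_col_fun A g i : block_col (block_fun A g) i = A i *m block_col g i.
Proof. by apply/colP => k; rewrite mxE. Qed.

Lemma sqr_block_col (g : J -> R) i :
  ((block_col g i)^T *m block_col g i) 0 0 = \sum_k g (tag_ord i k) ^+ 2.
Proof. by rewrite mxE; apply: eq_bigr => k _; rewrite !mxE. Qed.

(** The hypothesis compares sums over whole blocks only, so [B] is first enlarged to the blocks it
    meets. *)
Lemma block_fun_bound A (t : R) (g : l2 R J) (B : {fset J}) :
  (forall i (u : 'cV[R]_(d i)),
    ((A i *m u)^T *m (A i *m u)) 0 0 <= t ^+ 2 * (u^T *m u) 0 0) ->
  fsum (fun j => block_fun A g j ^+ 2) B <= t ^+ 2 * l2dot g g.
Proof.
move=> At; apply: le_trans (le_fsum _ (sub_blocks B)) _.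
  by move=> j; exact: sqr_ge0.
have := fsum_le_l2dot g (blocks [fset tag j | j in B]%fset).
move=> /(ler_wpM2l (sqr_ge0 t)); apply: le_trans.
rewrite !fsum_blocks mulr_sumr; apply: ler_sum => i _.
by rewrite -!sqr_block_col block_col_fun.
Qed.

Lemma block_fun_l2 A (g : l2 R J) : block_bounded A ->
  block_fun A g \in @square_summable R J.
Proof.
move=> [t _ At]; apply/asboolP; exists (t ^+ 2 * l2dot g g) => B.
exact: block_fun_bound.
Qed.

Definition block_l2 A (hA : block_bounded A) (g : l2 R J) : l2 R J :=
  L2 (block_fun_l2 g hA).

Lemma block_l2_bounded A (hA : block_bounded A) :
  (block_l2 hA : l2_hilbert R J -> l2_hilbert R J) \in
    @is_bounded_operator R (l2_hilbert R J).
Proof.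
apply/asboolP; split.
  move=> a g h; apply: l2_eqP => j; rewrite l2D l2Z /= /block_fun.
  rewrite (_ : block_col _ _ = a *: block_col g (tag j) + block_col h (tag j)).
    by rewrite mulmxDr -scalemxAr !mxE.
  by apply/colP => k; rewrite !mxE.
have [t t0 At] := hA; exists t => g.
rewrite -(@ler_pXn2r _ 2)// ?nnegrE ?mulr_ge0// ?(ltW t0)// exprMn.
rewrite -!l2dot_norm; apply: l2dot_le => B; exact: block_fun_bound.
Qed.

Definition block_operator A (hA : block_bounded A) :
    bounded_operator (l2_hilbert R J) :=
  BoundedOperator (block_l2_bounded hA).

(** Reduces statements on inner products, such as adjointness and positivity, to single
    finite-dimensional blocks. *)
Lemma cvg_hdot_block A (hA : block_bounded A) (g h : l2_hilbert R J) :
  (fun S : {fset I} =>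
      \sum_(i <- S) ((block_col g i)^T *m (A i)^T *m block_col h i) 0 0)
    @ totally --> (hdot (block_operator hA g) h : R).
Proof.
have := @cvg_l2dot_blocks (block_l2 hA g) h; apply: cvg_trans.
apply: near_eq_cvg; apply: nearW => S; apply: eq_bigr => i _.
by rewrite block_col_fun trmx_mul.
Qed.

Definition l2_delta_fun (j : J) : J -> R := fun j' => (j' == j)%:R.

Lemma l2_delta_summable j : l2_delta_fun j \in @square_summable R J.
Proof.
apply/asboolP; exists 1 => B.
(* With [j] adjoined the sum is exactly 1. *)
apply: (@le_trans _ _ (fsum (l2_delta_fun j) (j |` B)%fset)).
  apply: le_trans (le_fsum _ (fsubsetU1 j B)) _ => [j'|]; first exact: sqr_ge0.
  apply: ler_sum => j' _; rewrite /l2_delta_fun.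
  by case: eqP; rewrite ?expr0n ?expr1n.
rewrite /fsum (big_fsetD1 j) ?fset1U1//= /l2_delta_fun eqxx big_seq.
rewrite big1 ?addr0// => j'.
by rewrite !inE => /andP[/negPf ->].
Qed.

Definition l2_delta j : l2 R J := L2 (l2_delta_summable j).

Lemma l2dot_delta (g : l2 R J) j : l2dot g (l2_delta j) = g j.
Proof.
apply: l2dot_eq; apply: cvg_near_cst; near=> B.
have jB : j \in B by rewrite -fsub1set; near: B; exact: near_totally.
rewrite /fsum (big_fsetD1 j)//= /l2_delta_fun eqxx mulr1 big_seq big1 ?addr0// => j'.
by rewrite !inE => /andP[/negPf ->]; rewrite mulr0.
Unshelve. all: by end_near. Qed.

Lemma hdot_block_delta A (hA : block_bounded A) i (k l : 'I_(d i)) :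
  hdot (block_operator hA (l2_delta (tag_ord i l)) : l2_hilbert R J)
    (l2_delta (tag_ord i k) : l2_hilbert R J) = A i k l :> R.
Proof.
rewrite [LHS]l2dot_delta /= /block_fun /= mxE (bigD1 l)//= mxE /l2_delta_fun eqxx.
rewrite mulr1 big1 ?addr0// => m ml; rewrite mxE eq_Tagged/= (negPf ml) mulr0//.
Qed.

End BlockOperators.

(** * The universal representation *)

Section Embedding.
Variables (R : realType) (V : lmodType R) (star : {linear V -> V}).
Variables (C : forall n, set 'M[V]_n) (e : V).
Arguments C : clear implicits.
Hypothesis hV : real_operator_system star C e.

HB.instance Definition _ := gen_eqMixin (ucp_map star C e).
HB.instance Definition _ := gen_choiceMixin (ucp_map star C e).

Local Notation ucp := (ucp_map star C e).
Local Notation dim := (@ucp_dim R V star C e).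
Local Notation J := {f : ucp & 'I_(dim f)}.

Definition universal_space : hilbertType R := l2_hilbert R J.

Lemma ucp_block_bounded (v : V) : @block_bounded R ucp dim (fun f => f v).
Proof. exact: ucp_bounded. Qed.

Definition universal_rep (v : V) : bounded_operator universal_space :=
  block_operator (ucp_block_bounded v).

Lemma universal_rep_linear : linear universal_rep.
Proof.
move=> a v w; apply/val_inj/funext => g; apply: l2_eqP => j.
rewrite /= !fctE /= /block_fun.
by rewrite ucp_linear mulmxDl -scalemxAl !mxE.
Qed.

HB.instance Definition _ := GRing.isLinear.Build _ _ _ _ universal_rep
  universal_rep_linear.

Lemma universal_rep_unit : universal_rep e = id_operator universal_space.
Proof.
apply/val_inj/funext => g; apply: l2_eqP => -[f k].
by rewrite /= /block_fun /= ucp_unit mul1mx mxE.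
Qed.

(** Both sides are limits of the same sums over blocks, since each [f] turns [star] into
    transposition. *)
Lemma universal_rep_star v : is_adjoint (universal_rep v) (universal_rep (star v)).
Proof.
move=> g h.
rewrite (_ : hdot g _ = hdot (universal_rep (star v) h) g); last exact: l2dotC.
have := @cvg_hdot_block R ucp dim _ (ucp_block_bounded (star v)) h g.
have := @cvg_hdot_block R ucp dim _ (ucp_block_bounded v) g h.
rewrite (_ : (fun S : {fset ucp} => _) = (fun S : {fset ucp} => 
    \sum_(f <- S) ((block_col h f)^T *m (f (star v))^T *m block_col g f) 0 0)).
  by move=> H1 H2; exact: (cvg_unique _ H1 H2).
apply/funext => S; apply: eq_bigr => f _.
rewrite ucp_star trmxK.
transitivity (((block_col h f)^T *m f v *m block_col g f)^T 0 0).
  by rewrite !trmx_mul trmxK mulmxA.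
by rewrite mxE.
Qed.

Lemma universal_rep_delta v (f : ucp) k l :
  hdot (universal_rep v (l2_delta R (Tagged (fun f : ucp => 'I_(dim f)) l)))
    (l2_delta R (Tagged (fun f : ucp => 'I_(dim f)) k) : universal_space) = f v k l.
Proof. exact: hdot_block_delta. Qed.

Lemma cone_of_ucp n (x : 'M[V]_n) : (0 < n)%N -> mxstar star x = x ->
  (forall (f : ucp) (xi : 'M[R]_(n, dim f)), 0 <= cpform f xi x) -> C n x.
Proof.
move=> n0 xsa fx; apply: contrapT => /(ucp_separation hV n0 xsa)[f [xi]].
by rewrite ltNge fx.
Qed.

Lemma ucp0_eq0 (v : V) : (forall f : ucp, f v = 0) -> v = 0.
Proof.
move=> fv.
pose x : 'M[V]_(1 + 1) := offdiag star v.
have fx0 (f : ucp) k l : f (x k l) = 0 /\ f (- x k l) = 0.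
  have fx : f (x k l) = 0.
    rewrite /x; case: (splitP k) => k' /= kk'; case: (splitP l) => l' /= ll'.
    - have -> : k = lshift 1 k' by exact: val_inj.
      have -> : l = lshift 1 l' by exact: val_inj.
      by rewrite block_mxEul mxE linear0.
    - have -> : k = lshift 1 k' by exact: val_inj.
      have -> : l = rshift 1 l' by exact: val_inj.
      by rewrite block_mxEur mxE fv.
    - have -> : k = rshift 1 k' by exact: val_inj.
      have -> : l = lshift 1 l' by exact: val_inj.
      by rewrite block_mxEdl mxE ucp_star fv trmx0.
    - have -> : k = rshift 1 k' by exact: val_inj.
      have -> : l = rshift 1 l' by exact: val_inj.
      by rewrite block_mxEdr mxE linear0.
  by split => //; rewrite linearN /= fx oppr0.
have xsa : mxstar star x = x by exact: (mxstar_offdiag hV).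
have nxsa : mxstar star (- x) = - x.
  by rewrite -[in RHS]xsa; apply/matrixP => i j; rewrite !mxE linearN.
have Cx : C (1 + 1) x.
  apply: cone_of_ucp => // f xi; apply: sumr_ge0 => k _; apply: sumr_ge0 => l _.
  by rewrite (fx0 f k l).1 mulmx0 mul0mx mxE.
have Cnx : C (1 + 1) (- x).
  apply: cone_of_ucp => // f xi; apply: sumr_ge0 => k _; apply: sumr_ge0 => l _.
  by rewrite [(- x) k l]mxE (fx0 f k l).2 mulmx0 mul0mx mxE.
have /seteqP[H _] := ros_proper hV (isT : (0 < 1 + 1)%N).
have x0 : x = 0 by apply: H; split => //; exists (- x) => //; rewrite opprK.
have : x (lshift 1 0) (rshift 1 0) = 0 by rewrite x0 mxE.
by rewrite /x block_mxEur mxE.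
Qed.

Lemma ucp_inj (v w : V) : (forall f : ucp, f v = f w) -> v = w.
Proof.
move=> fvw; apply/eqP; rewrite -subr_eq0; apply/eqP/ucp0_eq0 => f.
by rewrite linearB /= fvw subrr.
Qed.

Lemma universal_rep_inj : injective universal_rep.
Proof.
move=> v w vw; apply: ucp_inj => f; apply/matrixP => k l.
by rewrite -!universal_rep_delta vw.
Qed.

(** The copy of [c] inside the summand of [f]; testing on such vectors recovers the single map
    [f]. *)
Definition ucp_vec (f : ucp) (c : 'rV[R]_(dim f)) : universal_space :=
  \sum_l c 0 l *:
    (l2_delta R (Tagged (fun f : ucp => 'I_(dim f)) l) : universal_space).

Lemma hdot_ucp_vec (f : ucp) v (c d : 'rV[R]_(dim f)) :
  hdot (universal_rep v (ucp_vec c)) (ucp_vec d) = (d *m f v *m c^T) 0 0.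
Proof.
rewrite mulmx_row_col linear_sumr; apply: eq_bigr => k _.
rewrite linear_sum linear_sumlz; apply: eq_bigr => l _.
rewrite linearZr_LR linearZ linearZl_LR /= universal_rep_delta; ring.
Qed.

(** * Positivity in the cone and in the representation *)

Section Positivity.
Variables (n : nat) (n0 : (0 < n)%N) (x : 'M[V]_n).

Lemma hdotn_universal_rep (h k : 'I_n -> universal_space) :
  hdotn (opmx_app (map_mx universal_rep x) h) k =
  \sum_i \sum_j hdot (universal_rep (x i j) (h j)) (k i).
Proof.
apply: eq_bigr => i _; rewrite /opmx_app linear_sumlz.
by apply: eq_bigr => j _; rewrite mxE.
Qed.

Lemma hdotn_universal_rep_star (h k : 'I_n -> universal_space) :
  hdotn h (opmx_app (map_mx universal_rep x) k) =
  \sum_i \sum_j hdot (universal_rep (star (x i j)) (h i)) (k j).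
Proof.
apply: eq_bigr => i _; rewrite /opmx_app linear_sumr.
apply: eq_bigr => j _; rewrite universal_rep_star (ros_involution hV).
by rewrite mxE.
Qed.

(** The quadratic form is a limit of finite sums of values [cpform f], each nonnegative when [x] is
    in the cone. *)
Lemma cvg_hdotn_universal_rep (h : 'I_n -> universal_space) :
  (fun S : {fset ucp} => \sum_(f <- S)
      cpform f (\matrix_(i, k) h i (Tagged (fun f : ucp => 'I_(dim f)) k)) x)
    @ totally --> hdotn (opmx_app (map_mx universal_rep x) h) h.
Proof.
rewrite hdotn_universal_rep.
rewrite (_ : (fun S : {fset ucp} => _) = (fun S : {fset ucp} =>
    \sum_i \sum_j \sum_(f <- S)
      ((block_col (h j) f)^T *m (f (x i j))^T *m block_col (h i) f) 0 0)).
  apply: cvg_big => [|i _]; first exact: add_continuous.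
  apply: cvg_big => [|j _]; first exact: add_continuous.
  exact: (@cvg_hdot_block R ucp dim _ (ucp_block_bounded (x i j))).
apply/funext => S; rewrite /cpform exchange_big; apply: eq_bigr => i _.
rewrite exchange_big; apply: eq_bigr => j _; apply: eq_bigr => f _.
transitivity (((block_col (h j) f)^T *m (f (x i j))^T *m block_col (h i) f)^T 0 0).
  rewrite !trmx_mul !trmxK mulmxA; congr ((_ *m _ *m _) _ _).
    by apply/rowP => k; rewrite !mxE.
  by apply/colP => k; rewrite !mxE.
by rewrite mxE.
Qed.

Lemma universal_rep_pos : C n x -> opmx_pos (map_mx universal_rep x).
Proof.
move=> Cx; split=> [h k|h]; last first.
  apply: (cvgr_to_ge (@cvg_hdotn_universal_rep h)); apply: nearW => S.
  by apply: sumr_ge0 => f _; exact: ucp_pos.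
rewrite hdotn_universal_rep hdotn_universal_rep_star exchange_big.
apply: eq_bigr => j _; apply: eq_bigr => i _.
by have /matrixP/(_ i j) := cone_sa hV n0 Cx; rewrite !mxE => ->.
Qed.

Lemma universal_rep_pos_inv : opmx_pos (map_mx universal_rep x) -> C n x.
Proof.
move=> [xsym xpos]; apply: cone_of_ucp => // [|f xi].
  apply/matrixP => i j; rewrite !mxE; apply: ucp_inj => f; apply/matrixP => k l.
  (* Basis vectors of one summand, placed in slots [i] and [j], make the symmetry clause read off
     the [(k, l)] entry of [f (x i j)] and of [f (star (x j i))]. *)
  pose d (a : 'I_n) : 'rV[R]_(dim f) := if a == i then delta_mx 0 k else 0.
  pose c (a : 'I_n) : 'rV[R]_(dim f) := if a == j then delta_mx 0 l else 0.
  have := xsym (fun a => ucp_vec (c a)) (fun a => ucp_vec (d a)).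
  rewrite hdotn_universal_rep hdotn_universal_rep_star.
  have dc (F : 'I_n -> 'I_n -> V) :
      \sum_a \sum_b hdot (universal_rep (F a b) (ucp_vec (c b))) (ucp_vec (d a)) =
      f (F i j) k l.
    rewrite (bigD1 i)//= [X in _ + X]big1 ?addr0 => [|a ai]; last first.
      by rewrite big1// => b _; rewrite hdot_ucp_vec /d (negPf ai) !mul0mx mxE.
    rewrite (bigD1 j)//= [X in _ + X]big1 ?addr0 => [|b bj]; last first.
      by rewrite hdot_ucp_vec /c (negPf bj) trmx0 mulmx0 mxE.
    by rewrite hdot_ucp_vec /c /d !eqxx trmx_delta -rowE -colE !mxE.
  by rewrite dc exchange_big (dc (fun a b => star (x b a))) => ->.
(* On vectors from the summand of [f], the quadratic form is exactly [cpform f xi x]. *)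
have := xpos (fun i => ucp_vec (row i xi)).
rewrite hdotn_universal_rep; congr (is_true (_ <= _)); apply: eq_bigr => i _.
by apply: eq_bigr => j _; rewrite hdot_ucp_vec.
Qed.

End Positivity.

End Embedding.

Theorem theorem2p7 (R : realType) (V : lmodType R) (star : {linear V -> V})
    (C : forall n : nat, set 'M[V]_n) (e : V)
    (hV : real_operator_system star C e) :
  exists (H : hilbertType R) (pi : {linear V -> bounded_operator H}),
    unital_complete_order_embedding star C e pi.
Proof.
exists (universal_space star C e), (universal_rep hV); split.
- exact: universal_rep_inj.
- exact: universal_rep_unit.
- exact: universal_rep_star.
- move=> n n0 x; split; first exact: universal_rep_pos.
  exact: universal_rep_pos_inv.
Qed.
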